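(* Let $H=(V,E)$ be a hypergraph without empty edges, and $G=\mathcal{G}(H)$ its incidence graph. (1) For any $e\in E$: $e$ is a cut edge of $H$ if and only if $e$ is a cut vertex of $G$. (2) Let $|V|\ge 2$ and let $v\in V$ be such that $\{v\}\notin E$ (no edge has vertex set $\{v\}$). Then $v$ is a cut vertex of $H$ if and only if $v$ is a cut vertex of $G$.
   Context: A hypergraph $H=(V,E)$ consists of a nonempty finite vertex set $V$, a finite edge set $E$, and an incidence function $\psi:E\to 2^V$; edges are identified with their vertex sets (parallel edges allowed), and an edge with empty vertex set is an empty edge. Two distinct vertices are adjacent via $e$ if both lie in $e$; a walk is a sequence $v_0e_1v_1\dots e_kv_k$ with $v_{i-1},v_i$ adjacent via $e_i$. For an equivalence class $V'$ of ''joined by a walk'', the connected component is $(V',\{f\in E:\emptyset\ne f\subseteq V'\})$; $\omega(H)$ is the number of components. $H-e=(V,E\setminus\{e\})$; $e$ is a cut edge if $\omega(H-e)>\omega(H)$. For $|V|\ge2$ and $v\in V$, $H\backslash v$ has vertex set $V\setminus\{v\}$ and edges $e\setminus\{v\}$ for all $e\in E$ with $e\setminus\{v\}\ne\emptyset$; $v$ is a cut vertex of $H$ if $\omega(H\backslash v)>\omega(H)$. The incidence graph $\mathcal{G}(H)$ is the bipartite graph with vertex set $V\cup E$ and edge set $\{ve: v\in e\}$; a cut vertex of a graph $G$ is a vertex $x$ with $\omega(G- x)>\omega(G)$, where $\omega$ counts connected components. *)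

(* Defs.v *)
From HB Require Import structures.
From mathcomp Require Import all_boot.

Set Implicit Arguments.
Unset Strict Implicit.
Unset Printing Implicit Defensive.

(* Edges form a type of their own, mapped to vertex sets by the incidence
   function [inc], so parallel edges and empty edges are both allowed. *)
Record hypergraph := Hypergraph {
  vert : finType;
  edge : finType;
  inc : edge -> {set vert};
  vert_gt0 : 0 < #|vert|
}.

Definition adj_via (H : hypergraph) (e : edge H) (u v : vert H) : bool :=
  [&& u != v, u \in inc e & v \in inc e].

Definition adj (H : hypergraph) : rel (vert H) :=
  fun u v => [exists e, adj_via e u v].

(* [walk u s v]: for s = [:: (e_1, v_1); ...; (e_k, v_k)], the sequence
   u e_1 v_1 ... e_k v_k is a walk and v_k = v (u = v when k = 0). *)
Fixpoint walk (H : hypergraph) (u : vert H) (s : seq (edge H * vert H))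
    (v : vert H) : bool :=
  if s is (e, w) :: s' then adj_via e u w && walk w s' v else u == v.

Definition joined (H : hypergraph) : rel (vert H) := connect (@adj H).

Lemma joinedP (H : hypergraph) (u v : vert H) :
  reflect (exists s, walk u s v) (joined u v).
Proof.
apply: (iffP connectP) => [[p]|[s]].
  elim: p u => [|w p IHp] u /=; first by move=> _ ->; exists [::] => /=.
  case/andP=> /existsP[e uw] wp vE; have [s ws] := IHp w wp vE.
  by exists ((e, w) :: s); rewrite /= uw.
elim: s u => [|[e w] s IHs] u /=; first by move/eqP->; exists [::].
case/andP=> uw /IHs[p wp vE]; exists (w :: p) => //=.
by rewrite wp andbT; apply/existsP; exists e.
Qed.

Lemma adj_sym (H : hypergraph) : symmetric (@adj H).
Proof.
by move=> u v; apply: eq_existsb => e; rewrite /adj_via eq_sym [X in _ && X]andbC.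
Qed.

Lemma joined_equiv (H : hypergraph) : equivalence_rel (@joined H).
Proof.
have sym := sym_connect_sym (@adj_sym H).
move=> u v w; split=> [|uv]; first exact: connect0.
exact: same_connect.
Qed.

(* A component is recorded as its vertex set together with its edge set. *)
Definition component_of (H : hypergraph) (A : {set vert H}) :
    {set vert H} * {set edge H} :=
  (A, [set f | (inc f != set0) && (inc f \subset A)]).

Definition components (H : hypergraph) : {set {set vert H} * {set edge H}} :=
  [set component_of A | A in equivalence_partition (@joined H) [set: vert H]].

Definition omega (H : hypergraph) : nat := #|components H|.

Definition del_edge (H : hypergraph) (e : edge H) : hypergraph :=
  @Hypergraph (vert H) {f : edge H | f != e} (fun f => inc (val f))
    (vert_gt0 H).

Definition cut_edge (H : hypergraph) (e : edge H) : bool :=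
  omega H < omega (del_edge e).

Lemma del_vertex_gt0 (H : hypergraph) (v : vert H) :
  1 < #|vert H| -> 0 < #|{: {u : vert H | u != v}}|.
Proof. by rewrite card_sig => hV; rewrite (cardC1 v) -subn1 subn_gt0. Qed.

Definition del_vertex (H : hypergraph) (hV : 1 < #|vert H|) (v : vert H) :
    hypergraph :=
  @Hypergraph {u : vert H | u != v} {f : edge H | inc f :\ v != set0}
    (fun f => [set u | val u \in inc (val f) :\ v])
    (del_vertex_gt0 v hV).

Definition cut_vertex (H : hypergraph) (hV : 1 < #|vert H|) (v : vert H) :
    bool :=
  omega H < omega (del_vertex hV v).

Record graph := Graph {
  gvert : finType;
  gadj : rel gvert;
  gadj_sym : symmetric gadj;
  gadj_irr : irreflexive gadj
}.

Definition gomega (G : graph) : nat := n_comp (@gadj G) (gvert G).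

Section DelGraphVertex.
Variables (G : graph) (x : gvert G).

Definition del_gvertex_adj : rel {y : gvert G | y != x} :=
  fun y z => gadj (val y) (val z).

Lemma del_gvertex_sym : symmetric del_gvertex_adj.
Proof. by move=> y z; apply: gadj_sym. Qed.

Lemma del_gvertex_irr : irreflexive del_gvertex_adj.
Proof. by move=> y; apply: gadj_irr. Qed.

Definition del_gvertex : graph := Graph del_gvertex_sym del_gvertex_irr.

Definition gcut_vertex : bool := gomega G < gomega del_gvertex.

End DelGraphVertex.

Definition incidence_adj (H : hypergraph) : rel (vert H + edge H) :=
  fun x y => match x, y with
  | inl v, inr e => v \in inc e
  | inr e, inl v => v \in inc e
  | _, _ => false
  end.

Lemma incidence_adj_sym (H : hypergraph) : symmetric (@incidence_adj H).
Proof. by case=> [u|e] [v|f]. Qed.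

Lemma incidence_adj_irr (H : hypergraph) : irreflexive (@incidence_adj H).
Proof. by case. Qed.

Definition incidence_graph (H : hypergraph) : graph :=
  @Graph (vert H + edge H)%type (@incidence_adj H)
    (@incidence_adj_sym H) (@incidence_adj_irr H).

(* Main.v *)
Require Import Defs.
From HB Require Import structures.
From mathcomp Require Import all_boot.

(** Without empty edges, every edge node of the incidence graph is adjacent to
    a vertex node, and two vertex nodes are linked in the incidence graph
    exactly when they are joined by a walk; so both structures have equally
    many components. Deleting an edge, or a vertex [v] such that no edge equals
    [{v}], commutes with taking incidence graphs. *)

(** Each block contains exactly one root, so sending a root to its class is a bijection from the
    roots of [e] onto the blocks. *)
Lemma card_equivalence_partition_connect (T : finType) (e : rel T) :
  connect_sym e ->
  #|equivalence_partition (connect e) [set: T]| = n_comp e T.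
Proof.
move=> symE; pose cls x := [set y in [set: T] | connect e x y].
have clsE x y : (cls x == cls y) = connect e x y.
  apply/eqP/idP=> [/setP/(_ y)|xy]; first by rewrite !inE connect0.
  by apply/setP=> z; rewrite !inE (same_connect symE xy).
have cls_inj : {in predI (roots e) T &, injective cls}.
  move=> x y /andP[/eqP rx _] /andP[/eqP ry _] /eqP.
  by rewrite clsE => /(rootP symE); rewrite rx ry.
rewrite /n_comp_mem -(card_in_imset cls_inj).
apply: eq_card => A; apply/imsetP/imsetP => -[x xP ->].
  exists (root e x); first by rewrite inE /= (roots_root symE).
  by apply/eqP; rewrite clsE connect_root.
by exists x; rewrite ?inE.
Qed.

Lemma omega_n_comp (H : hypergraph) : omega H = n_comp (@adj H) (vert H).
Proof.
(* The first coordinate of [component_of A] is [A] itself, so recording the edge set does not change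
   the count. *)
rewrite /omega card_imset => [|A B []//].
apply: card_equivalence_partition_connect.
exact: sym_connect_sym (@adj_sym H).
Qed.

Lemma connect_incidence (H : hypergraph) (u v : vert H) :
  connect (@adj H) u v = connect (@incidence_adj H) (inl u) (inl v).
Proof.
apply/idP/idP=> /connectP[p].
  elim: p u => [|w p IHp] u /=; first by move=> _ ->.
  case/andP=> /existsP[e /and3P[_ ue we]] wp /(IHp _ wp); apply: connect_trans.
  by apply: (@connect_trans _ _ (inr e)); apply: connect1.
(* Two incidence steps are consumed at a time, hence induction on a bound for the length.
   Bipartiteness leaves only the empty path and paths starting with an edge node followed by a
   vertex node. *)
have [n] := ubnP (size p).
elim: n p u => // n IHn [|[//|e] [|[w|f] p]] u //=; first by move=> _ _ [->].
  move=> /ltnW size_p /and3P[ue we wp] /(IHn _ _ size_p wp).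
  (* The path may go to [e] and straight back to [u]; such a detour is dropped, since [adj] relates
     distinct vertices only. *)
  apply: connect_trans; have [-> //|uw] := eqVneq u w.
  by apply/connect1/existsP; exists e; apply/and3P.
by move=> _ /andP[].
Qed.

Lemma omega_incidence (H : hypergraph) :
  (forall e : edge H, inc e != set0) -> omega H = gomega (incidence_graph H).
Proof.
move=> inc_neq0; rewrite omega_n_comp; apply/esym.
(* [inl] induces a bijection on components: it preserves and reflects connection, and its image
   meets every component. *)
apply: (adjunction_n_comp inl) => //.
- exact: sym_connect_sym (@incidence_adj_sym H).
- exact: sym_connect_sym (@adj_sym H).
split=> [[u|e] _|u v _]; last exact: connect_incidence.
  by exists u; apply: connect0.
have [incE|[v ve]] := set_0Vmem (inc e); last by exists v; apply: connect1.
by have := inc_neq0 e; rewrite incE eqxx.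
Qed.

Lemma gomega_iso (G G' : graph) (h : gvert G' -> gvert G) :
  injective h -> (forall x, x \in codom h) ->
  (forall x y, gadj (h x) (h y) = gadj x y) ->
  gomega G = gomega G'.
Proof.
move=> h_inj h_surj hE; apply: (adjunction_n_comp h) => //.
- exact: sym_connect_sym (@gadj_sym G).
- exact: sym_connect_sym (@gadj_sym G').
- apply: strict_adjunction => //; first exact: sym_connect_sym (@gadj_sym G').
  by apply/subsetP=> x _; apply: h_surj.
Qed.

Lemma gomega_del_edge (H : hypergraph) (e : edge H) :
  gomega (del_gvertex (G := incidence_graph H) (inr e))
  = gomega (incidence_graph (del_edge e)).
Proof.
pose h (x : vert H + {f : edge H | f != e}) :
    {y : vert H + edge H | y != inr e} :=
  match x with
  | inl u => exist _ (inl u) isT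
  | inr f => exist _ (inr (val f)) (valP f)
  end.
apply: (gomega_iso (del_gvertex (G := incidence_graph H) (inr e))
  (incidence_graph (del_edge e)) h).
- by case=> [u|f] [w|g] /(congr1 val) //= [] => [->//|/val_inj->].
- move=> [[u|f] fe]; apply/codomP.
    by exists (inl u); apply: val_inj.
  by exists (inr (exist _ f fe)); apply: val_inj.
- by case=> [u|f] [w|g].
Qed.

(** Deleting [v] from the hypergraph discards edges that become empty, whereas the graph keeps their
    nodes as isolated ones. The hypothesis rules such edges out, which makes [h] surjective. *)
Lemma gomega_del_vertex (H : hypergraph) (hV : 1 < #|vert H|) (v : vert H) :
  (forall e : edge H, inc e :\ v != set0) ->
  gomega (del_gvertex (G := incidence_graph H) (inl v))
  = gomega (incidence_graph (del_vertex hV v)).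
Proof.
move=> incD1_neq0.
pose h (x : {u : vert H | u != v} + {f : edge H | inc f :\ v != set0}) :
    {y : vert H + edge H | y != inl v} :=
  match x with
  | inl u => exist _ (inl (val u)) (valP u)
  | inr f => exist _ (inr (val f)) isT
  end.
apply: (gomega_iso (del_gvertex (G := incidence_graph H) (inl v))
  (incidence_graph (del_vertex hV v)) h).
- by case=> [u|f] [w|g] /(congr1 val) //= [] /val_inj->.
- move=> [[u|f] uv]; apply/codomP.
    by exists (inl (exist _ u uv)); apply: val_inj.
  by exists (inr (exist _ f (incD1_neq0 f))); apply: val_inj.
- by case=> [[u uv]|f] [[w wv]|g] //=; rewrite /del_gvertex_adj /= !inE ?uv ?wv.
Qed.

Theorem theorem3p24 (H : hypergraph)
    (no_empty_edge : forall e : edge H, inc e != set0) :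
  (forall e : edge H,
     cut_edge e <-> gcut_vertex (G := incidence_graph H) (inr e))
  /\
  (forall (hV : 1 < #|vert H|) (v : vert H),
     (forall e : edge H, inc e != [set v]) ->
     (cut_vertex hV v <-> gcut_vertex (G := incidence_graph H) (inl v))).
Proof.
split=> [e|hV v no_v_edge].
  rewrite /cut_edge /gcut_vertex (omega_incidence H) //.
  rewrite (omega_incidence (del_edge e)) ?gomega_del_edge // => f.
  exact: no_empty_edge.
have incD1_neq0 (e : edge H) : inc e :\ v != set0.
  (* Only the empty set and [[set v]] become empty on removing [v]. *)
  by rewrite setD_eq0 subset1 negb_or no_v_edge no_empty_edge.
rewrite /cut_vertex /gcut_vertex (omega_incidence H) //.
rewrite (omega_incidence (del_vertex hV v)) ?(gomega_del_vertex _ hV) // => f.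
have [u uf] := set0Pn _ (valP f).
have uv : u != v by move: uf; rewrite !inE => /andP[].
by apply/set0Pn; exists (exist _ u uv); rewrite inE.
Qed.
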